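(* Let $n \ge 2$, let $A \in \mathbb{R}^{m\times n}$ be a matrix with non-trivial null space, let $B \in \mathbb{R}^{p\times m}$ be any matrix, and set $C = BA$. Let $W \in \mathbb{R}^{n\times n}$ be the diagonal matrix with diagonal entries $w_i = \|C e_i\|_2$, $i=1,\dots,n$. Assume that $$C e_l \neq c\, C e_q \quad \text{for all } l, q \in \{1,\dots,n\} \text{ with } l \neq q \text{ and all } c \in \mathbb{R}.$$ Then for every $j \in \{1,\dots,n\}$, the vector $e_j$ is the unique solution of $$\min_{x \in \mathbb{R}^n} \|W x\|_1 \quad \text{subject to} \quad A x = A e_j .$$
   Context: $e_1,\dots,e_n$ denote the standard Euclidean unit basis vectors of $\mathbb{R}^n$; $\|\cdot\|_1$ and $\|\cdot\|_2$ are the usual $\ell^1$- and Euclidean norms. *)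

(* Defs.v *)
From HB Require Import structures.
From mathcomp Require Import all_boot all_order all_algebra.
From mathcomp Require Import reals.

Set Implicit Arguments.
Unset Strict Implicit.
Unset Printing Implicit Defensive.

Import Order.TTheory GRing.Theory Num.Theory.

Local Open Scope ring_scope.

Definition unit_vec (R : realType) (n : nat) (i : 'I_n) : 'cV[R]_n :=
  delta_mx i 0.

(* The library norm of a matrix is the sup norm, so it cannot be used here. *)
Definition l1norm (R : realType) (n : nat) (x : 'cV[R]_n) : R :=
  \sum_(i < n) `|x i 0|.

Definition l2norm (R : realType) (n : nat) (x : 'cV[R]_n) : R :=
  Num.sqrt (\sum_(i < n) x i 0 ^+ 2).

Definition is_minimizer (R : realType) (T : Type) (f : T -> R)
    (feasible : T -> Prop) (x : T) : Prop :=
  feasible x /\ forall y, feasible y -> f x <= f y.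

Definition is_unique_minimizer (R : realType) (T : Type) (f : T -> R)
    (feasible : T -> Prop) (x : T) : Prop :=
  is_minimizer f feasible x /\
  forall y, is_minimizer f feasible y -> y = x.

(* Main.v *)
(** Write [u_i = C e_i] and [w_i = |u_i|_2]. If [A x = A e_j] then
    [u_j = \sum_i x_i u_i]; pairing with [u_j] and using Cauchy-Schwarz gives
    [w_j ^ 2 <= w_j \sum_i w_i |x_i|], that is [|W e_j|_1 <= |W x|_1]. As no two
    columns of [C] are parallel, Cauchy-Schwarz is strict for [i != j], so the
    inequality is strict as soon as [x] has a nonzero entry off position [j]. *)
Require Import Defs.
From mathcomp Require Import all_boot all_order all_algebra.
From mathcomp Require Import reals.
From mathcomp Require Import ring.

Set Implicit Arguments.
Unset Strict Implicit.
Unset Printing Implicit Defensive.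

Import Order.TTheory GRing.Theory Num.Theory.

Local Open Scope ring_scope.

Definition dot (R : realType) (n : nat) (u v : 'cV[R]_n) : R :=
  \sum_(i < n) u i 0 * v i 0.

Section Dot.
Variables (R : realType) (n : nat).
Implicit Types u v : 'cV[R]_n.

Lemma dotvv u : dot u u = l2norm u ^+ 2.
Proof.
by rewrite sqr_sqrtr ?sumr_ge0 // => i _; rewrite ?sqr_ge0 // expr2.
Qed.

Lemma l2norm_ge0 u : 0 <= l2norm u.
Proof. exact: sqrtr_ge0. Qed.

Lemma l2norm_gt0 u : u != 0 -> 0 < l2norm u.
Proof.
move=> u_neq0; rewrite sqrtr_gt0 lt_neqAle sumr_ge0 => [|i _]; last first.
  exact: sqr_ge0.
rewrite andbT eq_sym psumr_eq0 => [|i _]; last exact: sqr_ge0.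
apply: contra u_neq0 => /allP u0; apply/eqP/colP => i; rewrite mxE.
by apply/eqP; rewrite -sqrf_eq0; apply: u0; rewrite mem_index_enum.
Qed.

Lemma dot_subZ u v (c : R) :
  dot (u - c *: v) (u - c *: v) = dot u u - 2 * c * dot u v + c ^+ 2 * dot v v.
Proof.
rewrite /dot !mulr_sumr -sumrB -big_split /=; apply: eq_bigr => i _.
by rewrite !mxE; ring.
Qed.

Lemma dot_suml (I : finType) (x : I -> R) (u : I -> 'cV[R]_n) v :
  dot (\sum_i x i *: u i) v = \sum_i x i * dot (u i) v.
Proof.
under [RHS]eq_bigr do rewrite mulr_sumr.
rewrite exchange_big; apply: eq_bigr => k _.
by rewrite summxE mulr_suml; apply: eq_bigr => i _; rewrite mxE mulrA.
Qed.

(** Since [u] is not a multiple of [v], its component orthogonal to [v] is nonzero. The squared norm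
    of that component is [dot u u - dot u v ^+ 2 / dot v v], and its positivity rearranges to strict
    Cauchy-Schwarz. *)
Lemma dot_lt_l2norm u v :
  v != 0 -> (forall c : R, u <> c *: v) -> `|dot u v| < l2norm u * l2norm v.
Proof.
move=> v_neq0 u_npar; have v_gt0 := l2norm_gt0 v_neq0.
have vv_gt0 : 0 < dot v v by rewrite dotvv exprn_gt0.
(* [u - c v] is the component of [u] orthogonal to [v]. *)
set c := dot u v / dot v v.
have : 0 < dot (u - c *: v) (u - c *: v).
  by rewrite dotvv exprn_gt0 // l2norm_gt0 // subr_eq0; apply/eqP.
have -> : dot (u - c *: v) (u - c *: v) = dot u u - dot u v ^+ 2 / dot v v.
  by rewrite dot_subZ /c; field; rewrite gt_eqF.
rewrite subr_gt0 ltr_pdivrMr // !dotvv -exprMn -(real_normK (num_real _)).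
by rewrite ltr_pXn2r // nnegrE ?mulr_ge0 ?l2norm_ge0.
Qed.

End Dot.

Section Columns.
Variables (R : realType) (n p : nat) (C : 'M[R]_(p, n)).
Implicit Type x : 'cV[R]_n.

Let u (i : 'I_n) := C *m unit_vec R i.

Lemma mulmx_sum_unit_vec x : C *m x = \sum_i x i 0 *: u i.
Proof.
rewrite [in LHS](matrix_sum_delta x) mulmx_sumr; apply: eq_bigr => i _.
by rewrite big_ord1 -scalemxAr.
Qed.

Lemma l1norm_diag_mx (d : 'rV[R]_n) x : (forall i, 0 <= d 0 i) ->
  l1norm (diag_mx d *m x) = \sum_i d 0 i * `|x i 0|.
Proof.
move=> d_ge0; apply: eq_bigr => i _.
by rewrite mul_diag_mx mxE normrM ger0_norm.
Qed.

Lemma l1norm_diag_mx_unit_vec (d : 'rV[R]_n) j : (forall i, 0 <= d 0 i) ->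
  l1norm (diag_mx d *m unit_vec R j) = d 0 j.
Proof.
move=> d_ge0; rewrite l1norm_diag_mx // (bigD1 j) //= big1 => [|i /negPf ij].
  by rewrite mxE !eqxx normr1 mulr1 addr0.
by rewrite mxE ij normr0 mulr0.
Qed.

Lemma l2norm_lt_weighted_sum x j :
    (forall i, u i != 0) -> (forall i (c : R), i != j -> u i <> c *: u j) ->
    C *m x = u j -> x != unit_vec R j ->
  l2norm (u j) < \sum_i l2norm (u i) * `|x i 0|.
Proof.
move=> u_neq0 u_npar Cx x_neq; have wj_gt0 := l2norm_gt0 (u_neq0 j).
(* If [x] vanished off [j], then [C *m x = u j] would read [x j 0 *: u j = u j]; as [u j] is nonzero
   this forces [x j 0 = 1], hence [x = unit_vec R j]. *)
have [k kj xk_neq0] : exists2 k, k != j & x k 0 != 0.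
  apply/exists_inP; apply: contraNT x_neq => /exists_inPn x_off.
  have x0 i : i != j -> x i 0 = 0 by move=> /x_off; rewrite negbK => /eqP.
  have xj1 : x j 0 = 1.
    move: Cx; rewrite mulmx_sum_unit_vec (bigD1 j) //= big1 => [|i /x0 ->].
      rewrite addr0 => /eqP; rewrite -subr_eq0 -[X in _ - X]scale1r -scalerBl.
      by rewrite scaler_eq0 (negPf (u_neq0 j)) orbF subr_eq0 => /eqP.
    by rewrite scale0r.
  apply/eqP/colP => i; rewrite mxE eqxx andbT.
  by have [->|/x0] := eqVneq i j.
have lt_dot i : i != j -> `|dot (u i) (u j)| < l2norm (u i) * l2norm (u j).
  by move=> ij; apply: dot_lt_l2norm => // c; apply: u_npar.
(* After multiplication by [l2norm (u j)] the left side is [dot (u j) (u j)]; only its first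
   argument is expanded as [C *m x]. *)
rewrite -(ltr_pM2r wj_gt0) -expr2 -dotvv -{1}Cx mulmx_sum_unit_vec dot_suml.
apply: (le_lt_trans (ler_norm _)); apply: (le_lt_trans (ler_norm_sum _ _ _)).
(* The term at [k] supplies the strict inequality, from [k != j] and [x k 0 != 0]. The others need
   only a weak one, which at [j] is an equality. *)
rewrite mulr_suml (bigD1 k) //= [ltRHS](bigD1 k) //=.
apply: ltr_leD; first by rewrite normrM mulrC mulrAC ltr_pM2r ?normr_gt0 ?lt_dot.
apply: ler_sum => i _; rewrite normrM mulrC mulrAC ler_wpM2r //.
have [->|/lt_dot/ltW //] := eqVneq i j.
by rewrite dotvv ger0_norm ?sqr_ge0 // expr2.
Qed.

End Columns.

Theorem theorem3p1 (R : realType) (m n p : nat) (n_ge2 : (2 <= n)%N)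
    (A : 'M[R]_(m, n))
    (nontrivial_null : exists v : 'cV[R]_n, v != 0 /\ A *m v = 0)
    (B : 'M[R]_(p, m)) :
  let C : 'M[R]_(p, n) := B *m A in
  let W : 'M[R]_n := diag_mx (\row_(i < n) l2norm (C *m unit_vec R i)) in
  (forall (l q : 'I_n) (c : R), l != q ->
     C *m unit_vec R l <> c *: (C *m unit_vec R q)) ->
  forall j : 'I_n,
    is_unique_minimizer (fun x : 'cV[R]_n => l1norm (W *m x))
      (fun x : 'cV[R]_n => A *m x = A *m unit_vec R j) (unit_vec R j).
Proof.
move=> C W u_npar j.
(* The witness is index 1 when [j] is 0, and index 0 otherwise. *)
have [i0 i0j] : exists i : 'I_n, i != j.
  have lt0 : (0 < n)%N by apply: leq_trans n_ge2.
  have [j0|j0] := eqVneq (val j) 0%N.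
    by exists (Ordinal n_ge2); rewrite -val_eqE /= j0.
  by exists (Ordinal lt0); rewrite -val_eqE eq_sym.
(* A zero column would be 0 times any other column; [j] serves as the other column when [i != j],
   and [i0] when [i = j]. *)
have u_neq0 i : C *m unit_vec R i != 0.
  have [->|ij] := eqVneq i j; apply/eqP => u0.
    by apply: (u_npar j i0 0); rewrite 1?eq_sym // scale0r.
  by apply: (u_npar i j 0); rewrite // scale0r.
have w_ge0 i : 0 <= (\row_i l2norm (C *m unit_vec R i)) 0 i.
  by rewrite mxE l2norm_ge0.
have lt_obj y : A *m y = A *m unit_vec R j -> y != unit_vec R j ->
    l1norm (W *m unit_vec R j) < l1norm (W *m y).
  move=> Ay y_neq; rewrite l1norm_diag_mx_unit_vec // l1norm_diag_mx //.
  under [ltRHS]eq_bigr do rewrite mxE.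
  rewrite mxE; apply: l2norm_lt_weighted_sum => // [i c ij|].
    exact: u_npar.
  (* Applying [B] to the constraint gives [C *m y = C *m unit_vec R j]. *)
  by rewrite -!mulmxA Ay.
split=> [|y [Ay min_y]].
  split=> // y Ay; have [->//|y_neq] := eqVneq y (unit_vec R j).
  exact/ltW/lt_obj.
(* A minimizer [y] is compared with the feasible point [unit_vec R j], which is strictly better
   unless the two coincide. *)
by apply: contraTeq (min_y _ erefl) => y_neq; rewrite -ltNge lt_obj.
Qed.
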